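(* Let $K,N\ge 1$, let $c_1^M,\dots,c_K^M>0$ with $C^M=\sum_k c_k^M$, let $0\le r_1<r_2<\dots<r_K$, let $p=(p_1,\dots,p_N)$ with $p_i\ge 0$ and $p_{\max}=\max_ip_i$, and let $\epsilon$ be a random vector with a known distribution on $[0,1]^N$. With $\mathcal{F}_c$, $k_c$ and $\mathrm{cost}(\epsilon,c)$ as defined in the context, the function $f(c)=\mathbb{E}_\epsilon[\mathrm{cost}(\epsilon,c)]$ is convex on $\mathcal{F}_c$, and the output $\bar c_J$ of the projected stochastic subgradient descent algorithm described in the context satisfies $\mathbb{E}[f(\bar c_J)]\to\min_{c\in\mathcal{F}_c}f(c)$ as $J\to\infty$.
   Context: Feasible region: $\mathcal{F}_c=\{c\in\mathbb{R}^N: c\ge 0,\ \sum_{i=1}^N c_i\le C^M\}$. For $\epsilon\in[0,1]^N$ and $c\in\mathcal{F}_c$, the critical type is $k_c=\min\{q\in\{1,\dots,K\}:\sum_i\epsilon_ic_i\le\sum_{k=1}^q c_k^M\}$, and $\mathrm{cost}(\epsilon,c)=\sum_{k<k_c}(r_k-r_{k_c})c_k^M+\sum_{i=1}^N c_i(r_{k_c}\epsilon_i-p_i)$ (the optimal net cost of a cryptomining facility with $K$ machine types of capacities $c_k^M$ and per-unit mining rewards $r_k$, committing capacities $c_i$ to $N$ ancillary service programs with prices $p_i$ and deployment ratios $\epsilon_i$). Algorithm: let $D=C^M$ if $N=1$ and $D=\sqrt2\,C^M$ if $N\ge 2$; fix $M\ge1$ and $J\ge 1$, step sizes $\alpha_j=\frac{D}{\sqrt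 N\max(r_K,p_{\max})\sqrt j}$. Start from some $c^{(1)}\in\mathcal{F}_c$. For $j=1,\dots,J$: draw $M$ independent samples $\epsilon^{(1)},\dots,\epsilon^{(M)}$ of $\epsilon$, compute $g_j=\frac1M\sum_{m=1}^M\big(r_{k_c^{(m)}}\epsilon^{(m)}-p\big)$ where $k_c^{(m)}$ is the critical type for $(\epsilon^{(m)},c^{(j)})$, set $c^{(j+1)}$ to be the Euclidean projection of $c^{(j)}-\alpha_jg_j$ onto $\mathcal{F}_c$. Output $\bar c_J=\frac1J\sum_{j=1}^Jc^{(j)}$. *)

(* Defs.v *)
From HB Require Import structures.
From mathcomp Require Import all_boot all_order all_algebra.
From mathcomp Require Import all_classical all_reals all_analysis.

Set Implicit Arguments.
Unset Strict Implicit.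
Unset Printing Implicit Defensive.

Import Order.TTheory GRing.Theory Num.Theory.
Local Open Scope classical_set_scope.
Local Open Scope ring_scope.

(* Indices are 0-based: machine types k = 0..K-1 (paper: 1..K),
   ancillary programs i : 'I_N. Capacity vectors c are row vectors 'rV[R]_N;
   realizations of epsilon are N-tuples (N.-tuple R carries the product
   sigma-algebra in MathComp-Analysis). *)

Definition inF (R : realType) (N : nat) (CM : R) (c : 'rV[R]_N) : Prop :=
  (forall i, 0 <= c 0 i) /\ \sum_(i < N) c 0 i <= CM.

(* critical type k_c (0-based): the least q in {0..K-1} with
   sum_i eps_i c_i <= sum_{k <= q} cM_k; returns K if there is none
   (never happens for c in F_c and eps in [0,1]^N). *)
Definition kcrit (R : realType) (K N : nat) (cM : nat -> R)
  (e : N.-tuple R) (c : 'rV[R]_N) : nat :=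
  find (fun q => \sum_(i < N) tnth e i * c 0 i <= \sum_(k < q.+1) cM k)
       (iota 0 K).

Definition cost (R : realType) (K N : nat) (cM r : nat -> R) (p : 'rV[R]_N)
  (e : N.-tuple R) (c : 'rV[R]_N) : R :=
  let k := kcrit K cM e c in
  \sum_(j < k) (r j - r k) * cM j + \sum_(i < N) c 0 i * (r k * tnth e i - p 0 i).

Definition sqnorm (R : realType) (N : nat) (v : 'rV[R]_N) : R :=
  \sum_(i < N) v 0 i ^+ 2.

Definition is_proj_F (R : realType) (N : nat) (CM : R)
  (proj : 'rV[R]_N -> 'rV[R]_N) : Prop :=
  forall x, inF CM (proj x) /\
    (forall z, inF CM z -> sqnorm (proj x - x) <= sqnorm (z - x)).

Definition tvec (R : realType) (N : nat) (e : N.-tuple R) : 'rV[R]_N :=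
  \row_i tnth e i.

Definition pmax (R : realType) (N : nat) (p : 'rV[R]_N) : R :=
  \big[Num.max/0]_(i < N) p 0 i.

Definition stepsize (R : realType) (K N : nat) (CM : R) (r : nat -> R)
  (p : 'rV[R]_N) (j : nat) : R :=
  let D := if N == 1%N then CM else Num.sqrt 2 * CM in
  D / (Num.sqrt N%:R * Num.max (r K.-1) (pmax p) * Num.sqrt j%:R).

(* averaged stochastic subgradient g_j at iterate c, batch n = j-1 *)
Definition subgrad (R : realType) (K N M : nat) (cM r : nat -> R)
  (p : 'rV[R]_N) {T : Type} (X : nat -> 'I_M -> T -> N.-tuple R)
  (n : nat) (c : 'rV[R]_N) (w : T) : 'rV[R]_N :=
  (M%:R)^-1 *: \sum_(m < M) (r (kcrit K cM (X n m w) c) *: tvec (X n m w) - p).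

(* psgd n w = c^{(n+1)}: psgd 0 = c^{(1)}, and
   c^{(j+1)} = proj (c^{(j)} - alpha_j g_j), g_j using the samples X (j-1) m *)
Fixpoint psgd (R : realType) (K N M : nat) (CM : R) (cM r : nat -> R)
  (p : 'rV[R]_N) (proj : 'rV[R]_N -> 'rV[R]_N) (c1 : 'rV[R]_N)
  {T : Type} (X : nat -> 'I_M -> T -> N.-tuple R) (n : nat) (w : T)
  : 'rV[R]_N :=
  match n with
  | 0 => c1
  | n'.+1 =>
      let c := psgd K CM cM r p proj c1 X n' w in
      proj (c - stepsize K CM r p n *: subgrad K cM r p X n' c w)
  end.

Definition cbar (R : realType) (K N M : nat) (CM : R) (cM r : nat -> R)
  (p : 'rV[R]_N) (proj : 'rV[R]_N -> 'rV[R]_N) (c1 : 'rV[R]_N)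
  {T : Type} (X : nat -> 'I_M -> T -> N.-tuple R) (J : nat) (w : T)
  : 'rV[R]_N :=
  (J%:R)^-1 *: \sum_(n < J) psgd K CM cM r p proj c1 X n w.

Definition mutually_independent (R : realType) (d d' : measure_display)
  (Omega : measurableType d) (T : measurableType d') (I : eqType)
  (P : probability Omega R) (X : I -> Omega -> T) : Prop :=
  forall (S : seq I) (B : I -> set T), uniq S ->
    (forall i, i \in S -> measurable (B i)) ->
    P (\bigcap_(i in [set` S]) (X i @^-1` B i)) =
    (\prod_(i <- S) P (X i @^-1` B i))%E.

Definition fexp (R : realType) (d : measure_display) (Omega : measurableType d)
  (P : probability Omega R) (K N : nat) (cM r : nat -> R) (p : 'rV[R]_N)
  (eps : Omega -> N.-tuple R) (c : 'rV[R]_N) : R :=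
  fine (\int[P]_w (cost K cM r p (eps w) c)%:E)%E.

Definition convex_on_F (R : realType) (N : nat) (CM : R) (f : 'rV[R]_N -> R)
  : Prop :=
  forall (c c' : 'rV[R]_N) (t : R), inF CM c -> inF CM c' -> 0 <= t <= 1 ->
    f (t *: c + (1 - t) *: c') <= t * f c + (1 - t) * f c'.

(* Main.v *)
(** The cost is the maximum over the machine types of K affine functions of c,
    attained at the critical type; hence it is convex and Lipschitz in c, and
    [r_kc e - p] is a subgradient.  Convexity of the expected cost f follows, and
    f attains its minimum on the compact set F_c.

    Nonexpansiveness of the projection and a telescoping argument bound the
    cumulative linearized regret of the first J iterates by C sqrt J, with C the
    same for every outcome.  The j-th iterate depends only on earlier batches, so
    it is independent of the j-th batch and Fubini gives
    [E cost(eps_j, c_j) = E f(c_j)].  Integrating the regret bound and using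
    convexity, [E f(cbar_J)] exceeds the minimum by at most C / sqrt J.

    Samples are first clipped to [0,1]^N, which changes nothing almost surely. *)
Require Import Defs.
From HB Require Import structures.
From mathcomp Require Import all_boot all_order all_algebra.
From mathcomp Require Import all_classical all_reals all_analysis.
From mathcomp Require Import measurable_realfun ring lra.

Set Implicit Arguments.
Unset Strict Implicit.
Unset Printing Implicit Defensive.

Import Order.TTheory GRing.Theory Num.Theory.
Import numFieldNormedType.Exports.
Local Open Scope classical_set_scope.
Local Open Scope ring_scope.

(** * Scalar product, squared Euclidean norm and l1 norm on row vectors *)

Definition unit_box (R : realType) (N : nat) (e : N.-tuple R) : Prop :=
  forall i, 0 <= tnth e i <= 1.

Definition dotp (R : realType) (N : nat) (u v : 'rV[R]_N) : R :=
  \sum_(i < N) u 0 i * v 0 i.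

Definition l1norm (R : realType) (N : nat) (u : 'rV[R]_N) : R :=
  \sum_(i < N) `|u 0 i|.

Section euclidean.
Context (R : realType) (N : nat).
Implicit Types u v w : 'rV[R]_N.

Lemma sqnorm_ge0 u : 0 <= sqnorm u.
Proof. by apply: sumr_ge0 => i _; exact: sqr_ge0. Qed.

Lemma dotpN u v : dotp u (- v) = - dotp u v.
Proof. by rewrite -sumrN; apply: eq_bigr => i _; rewrite mxE mulrN. Qed.

Lemma dotpZl t u v : dotp (t *: u) v = t * dotp u v.
Proof. by rewrite mulr_sumr; apply: eq_bigr => i _; rewrite mxE mulrA. Qed.

Lemma dotp_suml (I : Type) (s : seq I) (F : I -> 'rV[R]_N) v :
  dotp (\sum_(i <- s) F i) v = \sum_(i <- s) dotp (F i) v.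
Proof.
rewrite /dotp exchange_big/=; apply: eq_bigr => i _.
by rewrite summxE mulr_suml.
Qed.

Lemma dotp_sumr (I : Type) (s : seq I) (F : I -> 'rV[R]_N) u :
  dotp u (\sum_(i <- s) F i) = \sum_(i <- s) dotp u (F i).
Proof.
rewrite /dotp exchange_big/=; apply: eq_bigr => i _.
by rewrite summxE mulr_sumr.
Qed.

Lemma sqnormDZ u v t :
  sqnorm (u + t *: v) = sqnorm u + 2 * t * dotp u v + t ^+ 2 * sqnorm v.
Proof.
rewrite /sqnorm /dotp !mulr_sumr -!big_split/=.
by apply: eq_bigr => i _; rewrite !mxE; ring.
Qed.

Lemma normr_coord_l1norm u i : `|u 0 i| <= l1norm u.
Proof. by rewrite /l1norm (bigD1 i)//= lerDl sumr_ge0. Qed.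

Lemma l1normN u : l1norm (- u) = l1norm u.
Proof. by apply: eq_bigr => i _; rewrite mxE normrN. Qed.

Lemma l1norm_ge0 u : 0 <= l1norm u.
Proof. exact: sumr_ge0. Qed.

Lemma sqnorm_le_l1norm u : sqnorm u <= l1norm u ^+ 2.
Proof.
rewrite expr2 {1}/l1norm mulr_suml; apply: ler_sum => i _.
rewrite -real_normK ?num_real// expr2 ler_wpM2l//; exact: normr_coord_l1norm.
Qed.

Lemma sqr_coord_sqnorm u i : u 0 i ^+ 2 <= sqnorm u.
Proof.
by rewrite /sqnorm (bigD1 i)//= lerDl; apply: sumr_ge0 => j _; exact: sqr_ge0.
Qed.

Lemma sqnorm_le_coord u (b : R) : (forall i, `|u 0 i| <= b) ->
  sqnorm u <= N%:R * b ^+ 2.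
Proof.
move=> ub; apply: (@le_trans _ _ (\sum_(i < N) b ^+ 2)); last first.
  by rewrite sumr_const card_ord mulr_natl.
apply: ler_sum => i _; rewrite -real_normK ?num_real//.
by rewrite ler_pXn2r ?nnegrE ?(le_trans _ (ub i)).
Qed.

Lemma normr_dotp_le u v (b : R) : (forall i, `|u 0 i| <= b) ->
  `|dotp u v| <= b * l1norm v.
Proof.
move=> ub; apply: le_trans (ler_norm_sum _ _ _) _.
rewrite mulr_sumr; apply: ler_sum => i _.
by rewrite normrM ler_wpM2r.
Qed.

End euclidean.

(** * The feasible region and the Euclidean projection onto it *)

Section projection.
Context (R : realType) (N : nat) (CM : R) (proj : 'rV[R]_N -> 'rV[R]_N).
Hypothesis projP : is_proj_F CM proj.
Implicit Types x y z : 'rV[R]_N.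

Lemma inF_conv x y (t : R) : inF CM x -> inF CM y -> 0 <= t <= 1 ->
  inF CM (t *: x + (1 - t) *: y).
Proof.
move=> [x0 xC] [y0 yC] /andP[t0 t1]; split=> [i|].
  by rewrite !mxE addr_ge0// mulr_ge0// subr_ge0.
under eq_bigr do rewrite !mxE.
rewrite big_split/= -!mulr_sumr.
have -> : CM = t * CM + (1 - t) * CM by ring.
by rewrite lerD// ler_wpM2l// subr_ge0.
Qed.

(** Feasible coordinates lie in [[0, CM]]. The bound is coarser than the squared diameter when
    [N > 2], which only affects the constant in front of [sqrt J]. *)
Lemma inF_sqnormB x y : inF CM x -> inF CM y -> sqnorm (x - y) <= N%:R * CM ^+ 2.
Proof.
have bnd z i : inF CM z -> 0 <= z 0 i <= CM.
  move=> [z0 zC]; rewrite z0/=; apply: le_trans zC.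
  by rewrite (bigD1 i)//= lerDl sumr_ge0.
move=> Fx Fy; apply: sqnorm_le_coord => i.
have /andP[x0 x1] := bnd _ i Fx; have /andP[y0 y1] := bnd _ i Fy.
by rewrite !mxE ler_norml; apply/andP; split; lra.
Qed.

Lemma inF_mean (J : nat) (x : nat -> 'rV[R]_N) : (0 < J)%N ->
  (forall n, inF CM (x n)) -> inF CM (J%:R^-1 *: \sum_(n < J) x n).
Proof.
move=> J0 Fx; split=> [i|].
  rewrite mxE summxE mulr_ge0 ?invr_ge0// sumr_ge0// => n _.
  exact: (Fx n).1.
under eq_bigr do rewrite mxE summxE.
rewrite -mulr_sumr exchange_big/= ler_pdivrMl ?ltr0n//.
rewrite -[J in J%:R * _]card_ord mulr_natl -sumr_const.
by apply: ler_sum => n _; exact: (Fx n).2.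
Qed.

Lemma proj_in x : inF CM (proj x).
Proof. exact: (projP x).1. Qed.

Lemma proj_id x : inF CM x -> proj x = x.
Proof.
move=> Fx; have := (projP x).2 _ Fx.
rewrite subrr {2}/sqnorm big1 => [h|i _]; last by rewrite mxE expr0n.
apply/rowP => i; apply/eqP; rewrite -subr_eq0 -sqrf_eq0 eq_le sqr_ge0 andbT.
by apply: le_trans h; have := sqr_coord_sqnorm (proj x - x) i; rewrite !mxE.
Qed.

(** First-order optimality: moving from [proj x] towards [z] by a fraction [t] stays feasible and
    cannot reduce the distance to [x]; expanding the square and dividing by [t] leaves
    [2 * a + t * b >= 0]. *)
Lemma proj_variational x z : inF CM z -> 0 <= dotp (proj x - x) (z - proj x).
Proof.
move=> Fz; set a := dotp _ _; set b := sqnorm (z - proj x).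
have b0 : 0 <= b by exact: sqnorm_ge0.
have key t : 0 < t -> t <= 1 -> 0 <= 2 * a + t * b.
  move=> t0 t1.
  have Ft : inF CM (t *: z + (1 - t) *: proj x).
    by apply: inF_conv => //; [exact: proj_in|rewrite (ltW t0)].
  have := (projP x).2 _ Ft.
  have -> : t *: z + (1 - t) *: proj x - x = (proj x - x) + t *: (z - proj x).
    by apply/rowP => i; rewrite !mxE; ring.
  rewrite sqnormDZ -/a -/b => h.
  by rewrite -(pmulr_rge0 _ t0); lra.
(* Instead of a limit [t -> 0], one explicit [t] refutes [a < 0]: with [t = - a / (b - a)] the term
   [t * b] is at most [- a], so [2 * a + t * b <= a < 0]. *)
rewrite leNgt; apply/negP => a0.
have ba : 0 < b - a by lra.
have t0 : 0 < - a / (b - a) by rewrite divr_gt0// oppr_gt0.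
have t1 : - a / (b - a) <= 1 by rewrite ler_pdivrMr//; lra.
have := key _ t0 t1.
have -> : - a / (b - a) * b = - a * (b / (b - a)) by ring.
have : b / (b - a) <= 1 by rewrite ler_pdivrMr//; lra.
by nra.
Qed.

(** Adding the variational inequalities at [x] and [y] gives [sqnorm u <= dotp (x - y) u]; expanding
    [sqnorm (x - y - u) >= 0] then takes the place of Cauchy-Schwarz. *)
Lemma proj_nonexpansive x y : sqnorm (proj x - proj y) <= sqnorm (x - y).
Proof.
have h1 := proj_variational x (proj_in y).
have h2 := proj_variational y (proj_in x).
set u := proj x - proj y.
have h3 : dotp (proj x - x) (proj y - proj x) + dotp (proj y - y) (proj x - proj y)
   = dotp (x - y) u - sqnorm u.
  rewrite /dotp /sqnorm -sumrN -!big_split/=.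
  by apply: eq_bigr => i _; rewrite !mxE; ring.
have h4 := sqnorm_ge0 (x - y + (-1) *: u).
rewrite sqnormDZ in h4; lra.
Qed.

(** The scalar, l1 form of nonexpansiveness; it serves the measurability and continuity criteria for
    Lipschitz functions. *)
Lemma proj_coord_lipschitz i x y :
  `|proj x 0 i - proj y 0 i| <= l1norm (x - y).
Proof.
rewrite -ler_sqr ?nnegrE ?l1norm_ge0// real_normK ?num_real//.
have := sqr_coord_sqnorm (proj x - proj y) i; rewrite !mxE => /le_trans; apply.
apply: le_trans (proj_nonexpansive _ _) _; exact: sqnorm_le_l1norm.
Qed.

(** Basic inequality of projected subgradient descent: [z] is its own projection, so
    nonexpansiveness compares [x - t *: g] with [z], and the square is expanded. *)
Lemma proj_step_sqnorm x z g (t : R) : inF CM z ->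
  sqnorm (proj (x - t *: g) - z) <=
  sqnorm (x - z) - 2 * t * dotp g (x - z) + t ^+ 2 * sqnorm g.
Proof.
move=> Fz; rewrite -{1}(proj_id Fz); apply: le_trans (proj_nonexpansive _ _) _.
have -> : x - t *: g - z = (x - z) + (- t) *: g.
  by apply/rowP => i; rewrite !mxE; ring.
rewrite sqnormDZ sqrrN.
have -> : dotp (x - z) g = dotp g (x - z).
  by apply: eq_bigr => i _; rewrite mulrC.
by rewrite mulrN mulNr.
Qed.

End projection.

(* The potential sqrt J * d J turns the weighted telescoping sum into an
   induction; 1 / sqrt (J + 1) <= 2 (sqrt (J + 1) - sqrt J) bounds the noise. *)
Lemma regret_sqrt_bound (R : realType) (a G D : R) (s d : nat -> R) :
  0 < a -> 0 <= G ->
  (forall n, 0 <= d n <= D) ->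
  (forall n, 2 * (a / Num.sqrt n.+1%:R) * s n <=
     d n - d n.+1 + (a / Num.sqrt n.+1%:R) ^+ 2 * G) ->
  forall J, \sum_(n < J) s n <= (D / (2 * a) + a * G) * Num.sqrt J%:R.
Proof.
move=> a0 G0 dD step J.
suff h : 2 * a * \sum_(n < J) s n + Num.sqrt J%:R * d J <=
    (D + 2 * a ^+ 2 * G) * Num.sqrt J%:R.
  have /andP[dJ0 _] := dD J.
  have -> : (D / (2 * a) + a * G) * Num.sqrt J%:R
    = (D + 2 * a ^+ 2 * G) * Num.sqrt J%:R / (2 * a).
    by field; rewrite gt_eqF.
  rewrite ler_pdivlMr ?mulr_gt0// mulrC.
  by apply: le_trans h; rewrite lerDl mulr_ge0// sqrtr_ge0.
elim: J => [|J IH]; first by rewrite big_ord0 sqrtr0 mul0r !mulr0 addr0.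
rewrite big_ord_recr/=.
have := step J.
set q := Num.sqrt J.+1%:R; set q0 := Num.sqrt J%:R in IH *.
have q_gt0 : 0 < q by rewrite sqrtr_gt0 ltr0n.
have q0_ge0 : 0 <= q0 by exact: sqrtr_ge0.
have q2 : q ^+ 2 = q0 ^+ 2 + 1.
  by rewrite !sqr_sqrtr ?ler0n// -natr1.
have q0q : q0 <= q by rewrite ler_wsqrtr// ler_nat.
move=> stepJ.
have h1 : 2 * a * s J <= q * (d J - d J.+1) + a ^+ 2 * G / q.
  rewrite -(ler_pM2l q_gt0) in stepJ; move: stepJ; congr (_ <= _);
    field; rewrite gt_eqF//.
have h2 : q^-1 <= 2 * (q - q0).
  rewrite -[_^-1]mul1r ler_pdivrMr//; nra.
have h3 : a ^+ 2 * G / q <= a ^+ 2 * G * (2 * (q - q0)).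
  by rewrite ler_wpM2l// mulr_ge0// sqr_ge0.
have /andP[_ dJD] := dD J.
have h4 : (q - q0) * d J <= (q - q0) * D by rewrite ler_wpM2l// subr_ge0.
nra.
Qed.

(** * The cost as a maximum of affine functions: subgradients, bounds, convexity *)

Section cost.
Context (R : realType) (K N : nat) (cM r : nat -> R) (p : 'rV[R]_N).
Hypothesis K0 : (0 < K)%N.
Hypothesis cM0 : forall k, (k < K)%N -> 0 < cM k.
Hypothesis r0 : 0 <= r 0%N.
Hypothesis rS : forall k, (k.+1 < K)%N -> r k < r k.+1.
Hypothesis p0 : forall i, 0 <= p 0 i.
Implicit Types (e : N.-tuple R) (c : 'rV[R]_N).

Local Notation CM := (\sum_(k < K) cM k).
Local Notation B := (Num.max (r K.-1) (pmax p)).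

(** The affine functions of [c] whose maximum is the cost; [cost] is convertible to the piece of
    index [kcrit]. *)
Definition cost_piece k e c : R :=
  \sum_(j < k) (r j - r k) * cM j + \sum_(i < N) c 0 i * (r k * tnth e i - p 0 i).

Definition subgrad1 e c : 'rV[R]_N := r (kcrit K cM e c) *: tvec e - p.

Lemma capacity_gt0 : 0 < CM.
Proof.
case: K K0 cM0 => // k _ c0; rewrite big_ord_recl ltr_wpDr ?c0//.
by apply: sumr_ge0 => i _; rewrite ltW// c0.
Qed.

Lemma capacity_mono m n : (m <= n)%N -> (n <= K)%N ->
  \sum_(k < m) cM k <= \sum_(k < n) cM k.
Proof.
elim: n => [|n IH]; first by rewrite leqn0 => /eqP->.
rewrite leq_eqVlt => /predU1P[->//|mn] nK.
by rewrite big_ord_recr/= ler_wpDr//; [exact/ltW/cM0|exact: IH (ltnW nK)].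
Qed.

(** The last type [K.-1] always passes the test, because the load is at most the sum of the [c 0 i],
    hence at most the total capacity. The default value [K] of [find] is thus excluded. *)
Lemma kcrit_lt e c : unit_box e -> inF CM c -> (kcrit K cM e c < K)%N.
Proof.
move=> ue [c0 cC]; rewrite /kcrit -{2}(size_iota 0 K) -has_find.
apply/hasP; exists K.-1; first by rewrite mem_iota add0n/= prednK.
rewrite prednK//; apply: le_trans cC; apply: ler_sum => i _.
by have /andP[e0 e1] := ue i; rewrite -[leRHS]mul1r ler_wpM2r.
Qed.

(** The increment is a reward gap times the excess of the load over the capacity of the first [k.+1]
    types, so its sign is decided by exactly the test that defines [kcrit]. *)
Lemma cost_pieceS k e c : cost_piece k.+1 e c - cost_piece k e c =
  (r k.+1 - r k) * (\sum_(i < N) tnth e i * c 0 i - \sum_(j < k.+1) cM j).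
Proof.
rewrite /cost_piece !big_ord_recr/= mulrBr !mulrDr !mulr_sumr.
have -> : \sum_(j < k) (r j - r k.+1) * cM j =
    \sum_(j < k) (r j - r k) * cM j - \sum_(j < k) (r k.+1 - r k) * cM j.
  by rewrite -sumrB; apply: eq_bigr => i _; ring.
have -> : \sum_(i < N) c 0 i * (r k.+1 * tnth e i - p 0 i) =
   \sum_(i < N) c 0 i * (r k * tnth e i - p 0 i) +
   \sum_(i < N) (r k.+1 - r k) * (tnth e i * c 0 i).
  by rewrite -big_split; apply: eq_bigr => i _ /=; ring.
ring.
Qed.

Lemma before_kcrit e c q : (q < kcrit K cM e c)%N ->
  \sum_(k < q.+1) cM k < \sum_(i < N) tnth e i * c 0 i.
Proof.
move=> qk; have qK : (q < K)%N.
  by rewrite (leq_trans qk)// -[leqRHS](size_iota 0) find_size.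
by have := before_find 0 qk; rewrite nth_iota//= add0n ltNge => ->.
Qed.

Lemma at_kcrit e c : (kcrit K cM e c < K)%N ->
  \sum_(i < N) tnth e i * c 0 i <= \sum_(k < (kcrit K cM e c).+1) cM k.
Proof.
move=> kK; have := kK; rewrite /kcrit -{2}(size_iota 0 K) -has_find.
by move=> /(nth_find 0); rewrite nth_iota.
Qed.

(** By the sign of the increments, the pieces are nondecreasing in [k] up to the critical type and
    nonincreasing after it. *)
Lemma cost_piece_le_cost k e c : unit_box e -> inF CM c -> (k < K)%N ->
  cost_piece k e c <= cost K cM r p e c.
Proof.
move=> ue Fc kK; change (cost K cM r p e c) with (cost_piece (kcrit K cM e c) e c).
have kcK := kcrit_lt ue Fc.
have r_le q : (q.+1 < K)%N -> 0 <= r q.+1 - r q.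
  by move=> qK; rewrite subr_ge0 ltW// rS.
have [kkc|kck] := leqP k (kcrit K cM e c).
- suff up m : (k <= m)%N -> (m <= kcrit K cM e c)%N ->
      cost_piece k e c <= cost_piece m e c by exact: up.
  elim: m => [|m IH]; first by rewrite leqn0 => /eqP->.
  rewrite leq_eqVlt => /predU1P[->//|km] mk.
  apply: le_trans (IH km (ltnW mk)) _.
  rewrite -subr_ge0 cost_pieceS mulr_ge0 ?r_le//; first exact: leq_ltn_trans kcK.
  by rewrite subr_ge0 ltW// before_kcrit.
- suff down m : (kcrit K cM e c <= m)%N -> (m < K)%N ->
      cost_piece m e c <= cost_piece (kcrit K cM e c) e c.
    by apply: down => //; exact: ltnW.
  elim: m => [|m IH]; first by rewrite leqn0 => /eqP->.
  rewrite leq_eqVlt => /predU1P[->//|km] mK.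
  apply: le_trans (IH km (ltnW mK)).
  rewrite -subr_ge0 -opprB cost_pieceS -mulrN opprB mulr_ge0 ?r_le//.
  rewrite subr_ge0; apply: le_trans (at_kcrit kcK) _.
  by rewrite capacity_mono// ltnW.
Qed.

(** The left side is the value at [c'] of the piece that is critical at [c], and every piece is
    dominated by the cost. *)
Lemma cost_subgradient e c c' : unit_box e -> inF CM c -> inF CM c' ->
  cost K cM r p e c + dotp (subgrad1 e c) (c' - c) <= cost K cM r p e c'.
Proof.
move=> ue Fc Fc'; apply: le_trans (cost_piece_le_cost ue Fc' (kcrit_lt ue Fc)).
rewrite le_eqVlt; apply/orP; left; apply/eqP.
rewrite /cost /cost_piece /= -addrA; congr (_ + _).
rewrite /dotp -big_split/=; apply: eq_bigr => i _; rewrite !mxE; ring.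
Qed.

Lemma reward_bounds k : (k < K)%N -> 0 <= r k <= r K.-1.
Proof.
move=> kK; have mono m n : (m <= n)%N -> (n < K)%N -> r m <= r n.
  elim: n => [|n IH]; first by rewrite leqn0 => /eqP->.
  rewrite leq_eqVlt => /predU1P[->//|mn] nK.
  by rewrite (le_trans (IH mn (ltnW nK)))// ltW// rS.
by rewrite (le_trans r0)/= ?mono// ?ltn_predL// -ltnS prednK.
Qed.

Lemma price_le_pmax i : p 0 i <= pmax p.
Proof. exact: le_bigmax. Qed.

Lemma slope_bound_ge0 : 0 <= B.
Proof.
rewrite le_max; apply/orP; left.
by have /reward_bounds/andP[_] := K0; apply: le_trans.
Qed.

(** Each coordinate is a difference of two numbers of [[0, B]]. *)
Lemma subgrad1_bound e c i : unit_box e -> inF CM c -> `|subgrad1 e c 0 i| <= B.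
Proof.
move=> ue Fc; have /andP[rk0 rkK] := reward_bounds (kcrit_lt ue Fc).
have /andP[e0 e1] := ue i.
have rB : r K.-1 <= B by rewrite le_max lexx.
have pB : p 0 i <= B by rewrite le_max price_le_pmax orbT.
have pi0 := p0 i.
rewrite !mxE ler_norml; apply/andP; split; nra.
Qed.

(** The subgradient inequalities at [c] and at [c'] bound the difference from both sides. *)
Lemma cost_lipschitz e c c' : unit_box e -> inF CM c -> inF CM c' ->
  `|cost K cM r p e c - cost K cM r p e c'| <= B * l1norm (c - c').
Proof.
move=> ue Fc Fc'.
have h1 := cost_subgradient ue Fc Fc'; have h2 := cost_subgradient ue Fc' Fc.
have b1 := normr_dotp_le (c' - c) (fun i => subgrad1_bound i ue Fc).
have b2 := normr_dotp_le (c - c') (fun i => subgrad1_bound i ue Fc').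
rewrite -opprB l1normN opprB in b1.
move: b1 b2; rewrite !ler_norml => /andP[b1 b1'] /andP[b2 b2'].
by apply/andP; split; lra.
Qed.

Lemma inF0 : inF CM (0 : 'rV[R]_N).
Proof.
split=> [i|]; first by rewrite mxE.
by rewrite big1 ?(ltW capacity_gt0)// => i _; rewrite mxE.
Qed.

(** With no committed capacity the load is zero and type [0] is critical; this anchors the uniform
    bound on the cost. *)
Lemma cost0 e : cost K cM r p e 0 = 0.
Proof.
have k0 : kcrit K cM e 0 = 0%N.
  rewrite /kcrit; case: K K0 cM0 => // K' _ cp /=.
  rewrite big1 => [|i _]; last by rewrite mxE mulr0.
  by rewrite big_ord_recl big_ord0 addr0 ltW ?cp.
rewrite /cost k0 big_ord0 add0r big1// => i _; by rewrite mxE mul0r.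
Qed.

Lemma cost_bounded e c : unit_box e -> inF CM c ->
  `|cost K cM r p e c| <= B * CM.
Proof.
move=> ue Fc; have := cost_lipschitz ue Fc inF0.
rewrite cost0 !subr0 => /le_trans; apply; rewrite ler_wpM2l ?slope_bound_ge0//.
rewrite /l1norm; under eq_bigr do rewrite ger0_norm ?Fc.1//.
exact: Fc.2.
Qed.

(** The subgradient inequalities from the mixture [z] towards its two endpoints are combined with
    weights [t] and [1 - t]; the linear terms cancel. *)
Lemma cost_convex e : unit_box e -> convex_on_F CM (cost K cM r p e).
Proof.
move=> ue c c' t Fc Fc' t01; set z := _ + _.
have Fz : inF CM z by exact: inF_conv.
have h1 := cost_subgradient ue Fz Fc; have h2 := cost_subgradient ue Fz Fc'.
have e1 : c - z = (1 - t) *: (c - c') by apply/rowP => i; rewrite !mxE; ring.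
have e2 : c' - z = (- t) *: (c - c') by apply/rowP => i; rewrite !mxE; ring.
have dotpZr u s v : dotp u (s *: v) = s * dotp u v :> R.
  by rewrite mulr_sumr; apply: eq_bigr => i _; rewrite mxE; ring.
rewrite e1 dotpZr in h1; rewrite e2 dotpZr in h2.
move/andP: t01 => [t0 t1].
nra.
Qed.

(** Jensen's inequality without induction: the subgradient inequalities at the mean [u] are summed,
    and the deviations [x n - u] add up to zero. *)
Lemma cost_mean_le e (J : nat) (x : nat -> 'rV[R]_N) : unit_box e -> (0 < J)%N ->
  (forall n, inF CM (x n)) ->
  cost K cM r p e (J%:R^-1 *: \sum_(n < J) x n) <=
  J%:R^-1 * \sum_(n < J) cost K cM r p e (x n).
Proof.
move=> ue J0 Fx; set u := _ *: _; have Fu : inF CM u by exact: inF_mean.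
have J1 : J%:R != 0 :> R by rewrite pnatr_eq0 -lt0n.
rewrite ler_pdivlMl ?ltr0n//.
apply: (@le_trans _ _ (\sum_(n < J)
    (cost K cM r p e u + dotp (subgrad1 e u) (x n - u)))).
  have xu : \sum_(n < J) (x n - u) = 0.
    by rewrite sumrB sumr_const card_ord -scaler_nat scalerA mulfV// scale1r subrr.
  rewrite big_split/= sumr_const card_ord mulr_natl -dotp_sumr xu.
  by rewrite /dotp [X in _ + X]big1 ?addr0// => i _; rewrite [X in _ * X]mxE mulr0.
by apply: ler_sum => n _; exact: cost_subgradient.
Qed.

End cost.

(** * Measurability of the critical type, the cost and Lipschitz functions; continuity of the
    latter *)

Section measurability.
Context (d : measure_display) (T : measurableType d) (R : realType) (N : nat).

(** Along the list, [find] unfolds into nested conditionals with measurable tests. *)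
Lemma measurable_find (I : Type) (s : seq I) (a : T -> I -> bool) :
  (forall i, measurable_fun setT (fun w => a w i)) ->
  measurable_fun setT (fun w => find (a w) s).
Proof.
move=> ma; elim: s => [|i s IH]/=; first exact: measurable_cst.
apply: measurable_fun_ifT => //.
exact: (measurableT_comp (f := S)).
Qed.

Lemma measurable_tnth_comp (E : T -> N.-tuple R) i :
  measurable_fun setT E -> measurable_fun setT (fun w => tnth (E w) i).
Proof. by move=> /measurable_fun_tnthP/(_ i). Qed.

Lemma measurable_kcrit (K : nat) (cM : nat -> R) (E : T -> N.-tuple R)
    (C : T -> 'rV[R]_N) :
  measurable_fun setT E -> (forall i, measurable_fun setT (fun w => C w 0 i)) ->
  measurable_fun setT (fun w => kcrit K cM (E w) (C w)).
Proof.
move=> mE mC; apply: (@measurable_find nat (iota 0 K) (fun w q =>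
  \sum_(i < N) tnth (E w) i * C w 0 i <= \sum_(k < q.+1) cM k)) => q.
apply: measurable_fun_ler => //; apply: measurable_sum => i.
by apply: measurable_funM => //; exact: measurable_tnth_comp.
Qed.

Lemma measurable_nat_comp (f : nat -> R) (k : T -> nat) :
  measurable_fun setT k -> measurable_fun setT (fun w => f (k w)).
Proof. by move=> mk; apply: (measurableT_comp (f := f)). Qed.

Lemma measurable_cost (K : nat) (cM r : nat -> R) (p : 'rV[R]_N)
    (E : T -> N.-tuple R) (C : T -> 'rV[R]_N) :
  measurable_fun setT E -> (forall i, measurable_fun setT (fun w => C w 0 i)) ->
  measurable_fun setT (fun w => cost K cM r p (E w) (C w)).
Proof.
move=> mE mC; have mk := measurable_kcrit K cM mE mC.
apply: measurable_funD.
  exact: (measurable_nat_comp (fun k => \sum_(j < k) (r j - r k) * cM j) mk).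
apply: measurable_sum => i; apply: measurable_funM => //.
apply: measurable_funB => //; apply: measurable_funM.
  exact: measurable_nat_comp.
exact: measurable_tnth_comp.
Qed.

Lemma rat_rV_approx (x : 'rV[R]_N) (e : R) : 0 < e ->
  exists q : 'rV[rat]_N, l1norm (x - map_mx ratr q) < e.
Proof.
(* Dividing by [N.+1] rather than [N] makes the sum of the [N] errors strictly less than [e] and
   covers [N = 0]. *)
move=> e0; set t := e / N.+1%:R; have t0 : 0 < t by rewrite divr_gt0.
have h i : exists q : rat, `|x 0 i - ratr q| < t.
  have /rat_in_itvoo[q] : x 0 i - t < x 0 i + t by lra.
  rewrite in_itv/= => /andP[q1 q2]; exists q.
  by rewrite ltr_norml; apply/andP; split; lra.
have [q hq] := choice h; exists (\row_i q i).
apply: (@le_lt_trans _ _ (\sum_(i < N) t)).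
  by apply: ler_sum => i _; rewrite !mxE ltW.
rewrite sumr_const card_ord -mulr_natl /t mulrCA gtr_pMr//.
by rewrite ltr_pdivrMr// mul1r ltr_nat.
Qed.

(* A Lipschitz function is the infimum of the cones [h q + L |x - q|] over
   rational points q, which reduces measurability to a countable union. *)
Lemma measurable_lipschitz_comp (h : 'rV[R]_N -> R) (L : R) (Y : T -> 'rV[R]_N) :
  (forall x y, `|h x - h y| <= L * l1norm (x - y)) ->
  (forall i, measurable_fun setT (fun w => Y w 0 i)) ->
  measurable_fun setT (fun w => h (Y w)).
Proof.
move=> hL mY; apply: (measurability _ (RGenInftyO.measurableE R)) => //.
move=> _ [_ [a ->] <-]; rewrite setTI.
have -> : (fun w => h (Y w)) @^-1` `]-oo, a[ =
    \bigcup_(q : 'rV[rat]_N)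
      [set w | h (map_mx ratr q) + L * l1norm (Y w - map_mx ratr q) < a].
  apply/seteqP; split=> [w|w [q _]] /=; rewrite in_itv/=; last first.
    apply: le_lt_trans; rewrite -lerBlDl.
    exact: le_trans (ler_norm _) (hL _ _).
  move=> ha; set e := a - h (Y w); have e0 : 0 < e by rewrite subr_gt0.
  have L0 : 0 < 2 * (`|L| + 1) by rewrite mulr_gt0// ltr_wpDl.
  have [q qe] := rat_rV_approx (Y w) (divr_gt0 e0 L0).
  exists q => //=; move: qe; rewrite ltr_pdivlMr// => qe.
  have := hL (Y w) (map_mx ratr q); rewrite ler_norml => /andP[h1 _].
  have l0 := l1norm_ge0 (Y w - map_mx ratr q).
  have L1 := ler_norm L; rewrite /e in qe; nra.
apply: countable_bigcupT_measurable => [|q]; first exact: countableP.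
have mh : measurable_fun setT
    (fun w => h (map_mx ratr q) + L * l1norm (Y w - map_mx ratr q)).
  apply: measurable_funD => //; apply: measurable_funM => //.
  apply: measurable_sum => i; apply: measurableT_comp => //.
  by under eq_fun do rewrite !mxE; exact: measurable_funB.
by have := mh measurableT `]-oo, a[%classic (measurable_itv _); rewrite setTI set_itvE.
Qed.

End measurability.

Lemma l1lipschitz_continuous (R : realType) (N : nat) (h : 'rV[R]_N -> R) (L : R) :
  (forall x y, `|h x - h y| <= L * l1norm (x - y)) -> continuous h.
Proof.
move=> hL x; apply/(@cvgrPdist_lt _ R^o _ _ (nbhs_filter x)) => e e0.
(* In a sup-norm ball of this radius the l1 distance is at most [N] times the radius; [L] has no
   assumed sign, and the [+ 1] keeps the denominator positive. *)
have t0 : 0 < e / (`|L| * N%:R + 1) by rewrite divr_gt0// ltr_wpDl ?mulr_ge0.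
apply: (@filterS _ _ (nbhs_filter x) (ball x (e / (`|L| * N%:R + 1)))); last first.
  exact: nbhsx_ballx.
move=> y xy.
apply: le_lt_trans (hL x y) _.
apply: (@le_lt_trans _ _ (`|L| * (N%:R * (e / (`|L| * N%:R + 1))))).
  apply: le_trans (ler_wpM2r (l1norm_ge0 _) (ler_norm L)) _; apply: ler_wpM2l => //.
  rewrite mulr_natl -[X in _ *+ X]card_ord -sumr_const; apply: ler_sum => i _.
  by have := xy.2 0 i => /ltW; rewrite !mxE.
rewrite !mulrA -[_ * e]mulrC -mulrA gtr_pMr// ltr_pdivrMr ?ltr_wpDl ?mulr_ge0//.
by rewrite mul1r ltrDl.
Qed.

(** * Independence of a sample from the sigma-algebra of other samples, and its effect on
    integrals *)

Section independence.
Context (R : realType) (d d' : measure_display) (Omega : measurableType d)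
  (T : measurableType d') (I : eqType) (P : probability Omega R)
  (X : I -> Omega -> T).

(** A pi-system for the sigma-algebra generated by the [X i] with [Q i]. The index lists are
    duplicate-free, as in [mutually_independent]. *)
Definition cylinders (Q : pred I) : set (set Omega) :=
  [set E | exists (S : seq I) (B : I -> set T),
    [/\ uniq S, all Q S, forall i, measurable (B i) &
        E = \bigcap_(i in [set` S]) (X i @^-1` B i)]].

(** The two index lists are merged, and an index absent from one of them is given the full set
    there. *)
Lemma cylinders_setI (Q : pred I) : setI_closed (cylinders Q).
Proof.
move=> _ _ [S1 [B1 [u1 Q1 m1 ->]]] [S2 [B2 [u2 Q2 m2 ->]]].
exists (undup (S1 ++ S2)), (fun i => (if i \in S1 then B1 i else setT) `&`
  (if i \in S2 then B2 i else setT)); split.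
- exact: undup_uniq.
- by apply/allP => i; rewrite mem_undup mem_cat => /orP[/(allP Q1)|/(allP Q2)].
- by move=> i; apply: measurableI; case: ifP.
- apply/seteqP; split=> w /=.
    move=> [h1 h2] i _ /=; split; case: ifP => // iS; [exact: h1|exact: h2].
  move=> h; split=> i /= iS; have := h i; rewrite /= mem_undup mem_cat iS ?orbT.
    by move=> /(_ isT)[].
  by move=> /(_ isT)[].
Qed.

Lemma measurable_cylinder (Q : pred I) i : Q i ->
  measurable_fun setT (X i : g_sigma_algebraType (cylinders Q) -> T).
Proof.
move=> Qi _ B mB; rewrite setTI; apply: sub_gen_smallest.
exists [:: i], (fun=> B); split => //=; first by rewrite Qi.
apply/seteqP; split=> w /=; first by move=> h j /=; rewrite inE => /eqP ->.
by apply; rewrite /= inE.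
Qed.

Hypothesis mX : forall i, measurable_fun setT (X i).
Hypothesis indX : mutually_independent P X.

Lemma measurable_bigcap_seq (S : seq I) (B : I -> set T) :
  (forall i, measurable (B i)) ->
  measurable (\bigcap_(i in [set` S]) (X i @^-1` B i)).
Proof.
move=> mB; elim: S => [|i S IH]; first by rewrite classical_sets.set_nil bigcap_set0.
have -> : [set` i :: S] = i |` [set` S].
  apply/seteqP; split=> j /=; rewrite inE; first by move/predU1P.
  by move=> h; apply/predU1P.
rewrite bigcap_setU1; apply: measurableI => //.
by rewrite -[X in measurable X]setTI; exact: mX.
Qed.

(** Pi-lambda argument: the events independent of [F] form a Dynkin system, which contains the
    cylinders by mutual independence. *)
Lemma independent_past (Q : pred I) i0 (A : set T) (E : set Omega) :
  ~~ Q i0 -> measurable A -> <<s cylinders Q >> E ->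
  P ((X i0 @^-1` A) `&` E) = (P (X i0 @^-1` A) * P E)%E.
Proof.
move=> Qi0 mA sE; set F := X i0 @^-1` A.
have mF : measurable F by rewrite -[X in measurable X]setTI; exact: mX.
suff : <<s cylinders Q >> `<=`
    [set E | measurable E /\ P (F `&` E) = (P F * P E)%E].
  by move=> /(_ _ sE)[].
apply: lambda_system_subset; [exact: cylinders_setI| | |by []].
- apply/dynkin_lambda_system; split.
  + by split=> //; rewrite setIT probability_setT mule1.
  + move=> D [mD PD]; split; first exact: measurableC.
    rewrite probability_setC// -setDE measureD//; last by rewrite ltey_eq fin_num_measure.
    rewrite [X in (_ - X)%E = _](_ : _ = (P F * P D)%E)//.
    by rewrite muleBr ?mule1 ?fin_num_measure// fin_num_adde_defr ?fin_num_measure.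
  + move=> D tD hD.
    have mD n : measurable (D n) by exact: (hD n).1.
    split; first exact: bigcup_measurable.
    rewrite setI_bigcupr measure_bigcup//; last 2 first.
    * by move=> n _; exact: measurableI.
    * exact: trivIset_setIl.
    rewrite measure_bigcup//.
    transitivity (\sum_(0 <= n <oo | n \in [set: nat]) (P F * P (D n)))%E.
      by apply: eq_eseriesr => n _; exact: (hD n).2.
    have <- : (fine (P F))%:E = P F by rewrite fineK// fin_num_measure.
    by rewrite nneseriesZl.
- move=> _ [S [B [uS QS mB ->]]]; split; first exact: measurable_bigcap_seq.
  have i0S : i0 \notin S by apply: contra Qi0 => /(allP QS).
  pose B' i := if i == i0 then A else B i.
  have mB' i : measurable (B' i) by rewrite /B'; case: ifP.
  have -> : \bigcap_(i in [set` S]) X i @^-1` B i =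
      \bigcap_(i in [set` S]) X i @^-1` B' i.
    apply: eq_bigcapr => i /= iS; rewrite /B'; case: eqP => // ii0.
    by rewrite ii0 (negbTE i0S) in iS.
  rewrite (indX uS)//.
  transitivity (P (\bigcap_(i in [set` i0 :: S]) X i @^-1` B' i)).
    congr (P _); apply/seteqP; split=> w /=.
      move=> [wF h] i /=; rewrite inE => /predU1P[->|/h//].
      by rewrite /B' eqxx.
    move=> h; split; first by have := h i0 (mem_head _ _); rewrite /= /B' eqxx.
    by move=> i /= iS; apply: h; rewrite /= inE iS orbT.
  rewrite indX//=; last by rewrite i0S.
  by rewrite big_cons /B' eqxx.
Qed.

End independence.

(** The joint law agrees with the product of the marginal laws on rectangles, hence everywhere;
    Tonelli's theorem applies to the nonnegative [phi]. *)
Lemma independent_integral (R : realType) (d d1 d2 : measure_display)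
    (Omega : measurableType d) (T1 : measurableType d1) (T2 : measurableType d2)
    (P : probability Omega R) (X : Omega -> T1) (Y : Omega -> T2)
    (phi : T1 * T2 -> \bar R) :
  measurable_fun setT X -> measurable_fun setT Y ->
  (forall A B, measurable A -> measurable B ->
    P (X @^-1` A `&` Y @^-1` B) = (P (X @^-1` A) * P (Y @^-1` B))%E) ->
  measurable_fun setT phi -> (forall x, 0 <= phi x)%E ->
  (\int[P]_w phi (X w, Y w) = \int[P]_w \int[P]_w' phi (X w', Y w))%E.
Proof.
move=> mX mY ind mphi phi0.
pose XM := isMeasurableFun.Build _ _ _ _ _ mX.
pose X' : {mfun Omega >-> T1} := HB.pack X XM.
pose YM := isMeasurableFun.Build _ _ _ _ _ mY.
pose Y' : {mfun Omega >-> T2} := HB.pack Y YM.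
have mXY : measurable_fun setT (fun w => (X w, Y w)) by exact: measurable_fun_pair.
pose XYM := isMeasurableFun.Build _ _ _ _ _ mXY.
pose XY' : {mfun Omega >-> (T1 * T2)%type} := HB.pack (fun w => (X w, Y w)) XYM.
transitivity (\int[distribution P XY']_z phi z)%E.
  by rewrite ge0_integral_pushforward.
transitivity (\int[distribution P X' \x distribution P Y']_z phi z)%E.
  apply: eq_measure_integral => A mA _; apply/esym.
  by apply: product_measure_unique => // B C ? ?; exact: ind.
rewrite fubini_tonelli2// ge0_integral_pushforward//.
- apply: eq_integral => w _ /=; rewrite /fubini_G ge0_integral_pushforward//.
  by apply: measurableT_comp => //; exact: measurable_fun_pair.
- exact: measurable_fun_fubini_tonelli_G.
- by move=> y _; exact: integral_ge0.
Qed.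

(** * Real-valued expectations *)

Section bounded_expectation.
Context (R : realType) (d : measure_display) (Omega : measurableType d)
  (P : probability Omega R).

Lemma bounded_integrable (g : Omega -> R) (b : R) :
  measurable_fun setT g -> (forall w, `|g w| <= b) ->
  P.-integrable setT (EFin \o g).
Proof.
move=> mg gb; apply: measurable_bounded_integrable => //.
  by rewrite ltey_eq fin_num_measure.
exists b; split; first exact: num_real.
by move=> y by_ w _ /=; rewrite (le_trans (gb w))// ltW.
Qed.

Lemma Rintegral_probability_cst (k : R) : (\int[P]_w k)%R = k.
Proof.
rewrite Rintegral_cst// [X in fine X](_ : _ = 1%E) ?mulr1//.
exact: probability_setT.
Qed.

(** Integrability and value are proved together because additivity in the induction step needs the
    tail to be integrable. *)
Lemma Rintegral_sum (I : Type) (s : seq I) (h : I -> Omega -> R) :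
  (forall i, P.-integrable setT (EFin \o h i)) ->
  P.-integrable setT (EFin \o (fun w => \sum_(i <- s) h i w)) /\
  (\int[P]_w (\sum_(i <- s) h i w))%R = \sum_(i <- s) (\int[P]_w h i w)%R.
Proof.
move=> ih; elim: s => [|i s [IH1 IH2]].
  rewrite big_nil; under [X in EFin \o X]eq_fun do rewrite big_nil.
  split; first exact: finite_measure_integrable_cst.
  by under eq_Rintegral do rewrite big_nil; exact: Rintegral_probability_cst.
rewrite big_cons -IH2; split.
  under [X in EFin \o X]eq_fun do rewrite big_cons.
  exact: (integrableD measurableT (ih i) IH1).
by under eq_Rintegral do rewrite big_cons; rewrite RintegralD.
Qed.

Lemma le_RintegralD_cst (g h : Omega -> R) (k : R) :
  P.-integrable setT (EFin \o g) -> P.-integrable setT (EFin \o h) ->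
  (forall w, g w <= h w + k) -> (\int[P]_w g w <= \int[P]_w h w + k)%R.
Proof.
move=> ig ih gh.
have ik : P.-integrable setT (EFin \o cst k).
  exact: finite_measure_integrable_cst.
rewrite -(Rintegral_probability_cst k) -RintegralD//.
apply: le_Rintegral => //.
exact: (integrableD measurableT ih ik).
Qed.

End bounded_expectation.

Lemma Rintegral_same_law (R : realType) (d d' : measure_display)
    (Omega : measurableType d) (T : measurableType d') (P : probability Omega R)
    (X Y : Omega -> T) (g : T -> R) :
  measurable_fun setT X -> measurable_fun setT Y ->
  (forall B, measurable B -> P (X @^-1` B) = P (Y @^-1` B)) ->
  measurable_fun setT g ->
  P.-integrable setT (EFin \o (g \o X)) -> P.-integrable setT (EFin \o (g \o Y)) ->
  (\int[P]_w g (X w) = \int[P]_w g (Y w))%R.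
Proof.
move=> mX mY XY /measurable_EFinP mg iX iY.
pose XM := isMeasurableFun.Build _ _ _ _ _ mX.
pose X' : {mfun Omega >-> T} := HB.pack X XM.
pose YM := isMeasurableFun.Build _ _ _ _ _ mY.
pose Y' : {mfun Omega >-> T} := HB.pack Y YM.
congr fine; transitivity (\int[distribution P X']_z (EFin \o g) z)%E.
  by rewrite integral_pushforward.
transitivity (\int[distribution P Y']_z (EFin \o g) z)%E.
  by apply: eq_measure_integral => A mA _; exact: XY.
by rewrite integral_pushforward.
Qed.

(** * Feasibility and measurability of the iterates *)

Section measurable_psgd.
Context (R : realType) (K N M : nat) (CM : R) (cM r : nat -> R) (p : 'rV[R]_N)
  (proj : 'rV[R]_N -> 'rV[R]_N) (c1 : 'rV[R]_N)
  (d : measure_display) (T : measurableType d)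
  (X : nat -> 'I_M -> T -> N.-tuple R).
Hypothesis projP : is_proj_F CM proj.

Lemma psgd_inF n w : inF CM c1 -> inF CM (psgd K CM cM r p proj c1 X n w).
Proof. by move=> Fc1; case: n => [//|n]; exact: proj_in. Qed.

(** Only batches before [n] are assumed measurable, and the sigma-algebra on [T] is arbitrary, so
    the lemma also applies to the sigma-algebra generated by the past. The projection is handled as
    a Lipschitz map. *)
Lemma measurable_psgd n :
  (forall n' m, (n' < n)%N -> measurable_fun setT (X n' m)) ->
  forall i, measurable_fun setT (fun w => psgd K CM cM r p proj c1 X n w 0 i).
Proof.
elim: n => [_ i|n IH mX i] /=; first exact: measurable_cst.
have {}IH := IH (fun n' m n'n => mX n' m (ltnW n'n)).
apply: (measurable_lipschitz_comp (h := fun x => proj x 0 i) (L := 1)).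
  by move=> x y; rewrite mul1r; exact: proj_coord_lipschitz.
move=> j; under eq_fun do rewrite !mxE summxE.
apply: measurable_funB => //; apply: measurable_funM => //.
apply: measurable_funM => //; apply: measurable_sum => m.
under eq_fun do rewrite !mxE.
have mXn : measurable_fun setT (X n m) by exact: mX.
apply: measurable_funB => //; apply: measurable_funM.
  exact/measurable_nat_comp/measurable_kcrit.
exact: measurable_tnth_comp.
Qed.

Lemma measurable_cbar J : (forall n m, measurable_fun setT (X n m)) ->
  forall i, measurable_fun setT (fun w => cbar K CM cM r p proj c1 X J w 0 i).
Proof.
move=> mX i; under eq_fun do rewrite mxE summxE.
apply: measurable_funM => //; apply: measurable_sum => n.
exact: measurable_psgd.
Qed.

End measurable_psgd.

(** Moves iterates to tuples, whose product sigma-algebra is the one used for their joint law with a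
    sample. *)
Definition row_tuple (R : realType) (N : nat) (x : 'rV[R]_N) : N.-tuple R :=
  [tuple x 0 i | i < N].

Lemma tnth_row_tuple (R : realType) (N : nat) (x : 'rV[R]_N) i :
  tnth (row_tuple x) i = x 0 i.
Proof. exact: tnth_mktuple. Qed.

(** * Expected cost, regret and convergence for samples that lie everywhere in the unit box *)

Section expected_cost.
Context (R : realType) (d : measure_display) (Omega : measurableType d)
  (P : probability Omega R) (K N M : nat) (cM r : nat -> R) (p : 'rV[R]_N)
  (eps : Omega -> N.-tuple R) (X : nat -> 'I_M -> Omega -> N.-tuple R)
  (proj : 'rV[R]_N -> 'rV[R]_N) (c1 : 'rV[R]_N).
Hypotheses (K0 : (0 < K)%N) (N0 : (0 < N)%N) (M0 : (0 < M)%N).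
Hypothesis cM0 : forall k, (k < K)%N -> 0 < cM k.
Hypothesis r0 : 0 <= r 0%N.
Hypothesis rS : forall k, (k.+1 < K)%N -> r k < r k.+1.
Hypothesis p0 : forall i, 0 <= p 0 i.
Hypothesis meps : measurable_fun setT eps.
Hypothesis mX : forall n m, measurable_fun setT (X n m).
Hypothesis lawX : forall n m (B : set (N.-tuple R)), measurable B ->
  P (X n m @^-1` B) = P (eps @^-1` B).
Hypothesis indX : mutually_independent P (fun s : nat * 'I_M => X s.1 s.2).
Hypothesis projP : is_proj_F (\sum_(k < K) cM k) proj.
Hypothesis Fc1 : inF (\sum_(k < K) cM k) c1.
Hypothesis ueps : forall w, unit_box (eps w).
Hypothesis uX : forall n m w, unit_box (X n m w).

Local Notation CM := (\sum_(k < K) cM k).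
Local Notation B := (Num.max (r K.-1) (pmax p)).
Local Notation f := (fexp P K cM r p eps).
Local Notation cost := (cost K cM r p).
Local Notation c_ := (psgd K CM cM r p proj c1 X).
Local Notation cbar_ := (cbar K CM cM r p proj c1 X).

Lemma cost_comp_integrable (E : Omega -> N.-tuple R) (C : Omega -> 'rV[R]_N) :
  measurable_fun setT E -> (forall i, measurable_fun setT (fun w => C w 0 i)) ->
  (forall w, unit_box (E w)) -> (forall w, inF CM (C w)) ->
  P.-integrable setT (EFin \o (fun w => cost (E w) (C w))).
Proof.
move=> mE mC uE FC; apply: (@bounded_integrable _ _ _ _ _ (B * CM)).
  exact: measurable_cost.
by move=> w; exact: cost_bounded.
Qed.

Lemma cost_eps_integrable c : inF CM c ->
  P.-integrable setT (EFin \o (fun w => cost (eps w) c)).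
Proof. by move=> Fc; apply: cost_comp_integrable. Qed.

Lemma fexp_convex : convex_on_F CM f.
Proof.
move=> c c' t Fc Fc' t01.
have ic := cost_eps_integrable Fc; have ic' := cost_eps_integrable Fc'.
rewrite /fexp -![fine _]/(Rintegral _ _ _) -!RintegralZl// -RintegralD//; last 2 first.
- exact: (integrableZl measurableT t ic).
- exact: (integrableZl measurableT (1 - t) ic').
apply: le_Rintegral => //.
- exact/cost_eps_integrable/inF_conv.
- exact: (integrableD measurableT (integrableZl measurableT t ic)
    (integrableZl measurableT (1 - t) ic')).
- by move=> w _; exact: cost_convex.
Qed.

Lemma fexp_lipschitz c c' : inF CM c -> inF CM c' ->
  `|f c - f c'| <= B * l1norm (c - c').
Proof.
move=> Fc Fc'.
have ic := cost_eps_integrable Fc; have ic' := cost_eps_integrable Fc'.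
have h w : `|cost (eps w) c - cost (eps w) c'| <= B * l1norm (c - c').
  exact: cost_lipschitz.
rewrite ler_distl; apply/andP; split; rewrite ?lerBlDr.
  apply: (le_RintegralD_cst ic' ic) => w; have := h w.
  by rewrite ler_distl lerBlDr => /andP[].
by apply: (le_RintegralD_cst ic ic') => w; have := h w; rewrite ler_distl => /andP[].
Qed.

Lemma fexp_bounded c : inF CM c -> `|f c| <= B * CM.
Proof.
move=> Fc; have ic := cost_eps_integrable Fc.
have h w : `|cost (eps w) c| <= B * CM by exact: cost_bounded.
rewrite ler_norml; apply/andP; split.
  have -> : - (B * CM) = (\int[P]_w (- (B * CM)))%R by rewrite Rintegral_probability_cst.
  apply: le_Rintegral => //; first exact: finite_measure_integrable_cst.
  by move=> w _; have := h w; rewrite ler_norml => /andP[].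
have -> : B * CM = (\int[P]_w (B * CM))%R by rewrite Rintegral_probability_cst.
apply: le_Rintegral => //; first exact: finite_measure_integrable_cst.
by move=> w _; have := h w; rewrite ler_norml => /andP[].
Qed.

(** Estimates for [f] hold on the feasible region only; composing with [proj] gives a function that
    is Lipschitz on the whole space. *)
Lemma fexp_proj_lipschitz x y :
  `|f (proj x) - f (proj y)| <= B * N%:R * l1norm (x - y).
Proof.
apply: le_trans (fexp_lipschitz (proj_in projP x) (proj_in projP y)) _.
rewrite -mulrA ler_wpM2l ?slope_bound_ge0//.
rewrite mulr_natl -[X in _ *+ X]card_ord -sumr_const; apply: ler_sum => i _.
by rewrite !mxE; exact: proj_coord_lipschitz.
Qed.

(** The continuous function [f \o proj] has a minimizer on the compact cube [[0, CM]^N], which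
    contains the feasible region; the projection of that minimizer is feasible, and [proj] fixes
    feasible points. *)
Lemma fexp_minimizer : exists2 c, inF CM c & forall c', inF CM c' -> f c <= f c'.
Proof.
pose A := [set x : 'rV[R]_N | forall i, `[0, CM]%classic (x 0 i)].
have cA : compact A by exact: (rV_compact (A := fun=> `[0, CM]%classic)
    (fun=> @segment_compact R 0 CM)).
have A0 : A !=set0.
  exists 0 => i /=; rewrite mxE in_itv/= lexx/= ltW//; exact: capacity_gt0.
have cf : continuous (fun x => f (proj x)).
  exact: l1lipschitz_continuous fexp_proj_lipschitz.
have [x _ xmin] := compact_EVT_min A0 cA (continuous_subspaceT cf).
exists (proj x); first exact: proj_in.
move=> c' Fc'; rewrite -(proj_id projP Fc'); apply: xmin.
rewrite inE => i /=; rewrite in_itv/= Fc'.1/=; apply: le_trans Fc'.2.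
by rewrite (bigD1 i)//= lerDl sumr_ge0// => j _; exact: Fc'.1.
Qed.

Lemma fexp_comp_integrable (C : Omega -> 'rV[R]_N) :
  (forall i, measurable_fun setT (fun w => C w 0 i)) ->
  (forall w, inF CM (C w)) -> P.-integrable setT (EFin \o (fun w => f (C w))).
Proof.
move=> mC FC; apply: (@bounded_integrable _ _ _ _ _ (B * CM)); last first.
  by move=> w; exact: fexp_bounded.
have -> : (fun w => f (C w)) = (fun w => f (proj (C w))).
  by apply/funext => w; rewrite (proj_id projP).
exact: (measurable_lipschitz_comp (h := fun x => f (proj x)) fexp_proj_lipschitz).
Qed.

Lemma psgd_in n w : inF CM (c_ n w).
Proof. exact: psgd_inF. Qed.

Lemma measurable_psgd_coord n i : measurable_fun setT (fun w => c_ n w 0 i).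
Proof. by apply: measurable_psgd => // n' m _; exact: mX. Qed.

Lemma cbar_in J w : inF CM (cbar_ J w).
Proof.
(* For [J = 0] the average is the zero vector, which is feasible. *)
case: J => [|J]; last exact: (inF_mean (x := c_ ^~ w)) (fun n => psgd_in n w).
by rewrite /cbar big_ord0 scaler0; exact: inF0.
Qed.

(* [c_ n] is measurable for the sigma-algebra generated by the batches before
   the n-th one. *)
Lemma batch_independent_of_iterate n m (A : set (N.-tuple R)) (D : set (N.-tuple R)) :
  measurable A -> measurable D ->
  P (X n m @^-1` A `&` (fun w => row_tuple (c_ n w)) @^-1` D) =
  (P (X n m @^-1` A) * P ((fun w => row_tuple (c_ n w)) @^-1` D))%E.
Proof.
move=> mA mD; pose Q (s : nat * 'I_M) := (s.1 < n)%N.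
apply: (independent_past (i0 := (n, m)) (Q := Q) (fun s => mX s.1 s.2) indX) => //.
  by rewrite /Q /= ltnn.
pose G := cylinders (fun s : nat * 'I_M => X s.1 s.2) Q.
have mY : measurable_fun setT ((fun w => row_tuple (c_ n w)) :
    g_sigma_algebraType G -> N.-tuple R).
  apply/measurable_fun_tnthP => i.
  rewrite (_ : _ \o _ = fun w => c_ n w 0 i); last first.
    by apply/funext => w; exact: tnth_row_tuple.
  apply: (@measurable_psgd _ _ _ _ _ _ _ _ _ _ _ (g_sigma_algebraType G)) => //.
  by move=> n' m' n'n; exact: (measurable_cylinder (i := (n', m'))).
by have := mY measurableT _ mD; rewrite setTI.
Qed.

Lemma expected_cost_sample n m c : inF CM c ->
  (\int[P]_w cost (X n m w) c)%R = f c.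
Proof.
move=> Fc; have mc i : measurable_fun setT (fun w : Omega => c 0 i) by [].
apply: (Rintegral_same_law (g := fun e => cost e c)) => //.
- exact: lawX.
- by apply: measurable_cost.
- exact: (cost_comp_integrable (mX n m)).
- exact: cost_eps_integrable.
Qed.

Lemma expected_cost_at_iterate n m :
  (\int[P]_w cost (X n m w) (c_ n w) = \int[P]_w f (c_ n w))%R.
Proof.
pose b := B * CM; pose Y w := row_tuple (c_ n w).
have mY : measurable_fun setT Y.
  apply/measurable_fun_tnthP => i; rewrite (_ : _ \o _ = fun w => c_ n w 0 i); last first.
    by apply/funext => w; exact: tnth_row_tuple.
  exact: measurable_psgd_coord.
have tY w : tvec (Y w) = c_ n w.
  by apply/rowP => i; rewrite mxE tnth_row_tuple.
(* Adding [b] makes the cost nonnegative on the box and the feasible region; the absolute value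
   extends nonnegativity to all pairs, as [independent_integral] requires. The shift is cancelled at
   the end. *)
pose phi (z : N.-tuple R * N.-tuple R) := `|cost z.1 (tvec z.2) + b|%:E.
have mphi : measurable_fun setT phi.
  apply/measurable_EFinP; apply: measurableT_comp => //.
  apply: measurable_funD => //; apply: measurable_cost => // i.
  under eq_fun do rewrite mxE; exact: measurable_tnth_comp.
have phi0 z : (0 <= phi z)%E by rewrite lee_fin.
have phiE e c : unit_box e -> inF CM (tvec c) ->
    phi (e, c) = (cost e (tvec c) + b)%:E.
  move=> ue Fc; congr EFin; apply: ger0_norm.
  have := cost_bounded K0 cM0 r0 rS p0 ue Fc.
  by rewrite ler_norml -/b => /andP[]; lra.
have h := independent_integral (mX n m) mY (@batch_independent_of_iterate n m) mphi phi0.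
have iX : P.-integrable setT (EFin \o (fun w => cost (X n m w) (c_ n w))).
  apply: cost_comp_integrable => //; first exact: measurable_psgd_coord.
  exact: psgd_in.
have ifc : P.-integrable setT (EFin \o (fun w => f (c_ n w))).
  by apply: fexp_comp_integrable; [exact: measurable_psgd_coord|exact: psgd_in].
have ib : P.-integrable setT (EFin \o cst b) by exact: finite_measure_integrable_cst.
have e1 : (\int[P]_w phi (X n m w, Y w))%E =
    ((\int[P]_w cost (X n m w) (c_ n w))%R + b)%:E.
  transitivity (\int[P]_w (cost (X n m w) (c_ n w) + b)%:E)%E.
    by apply: eq_integral => w _; rewrite phiE ?tY//; exact: psgd_in.
  rewrite -{2}(Rintegral_probability_cst P b) -RintegralD// /Rintegral fineK//.
  apply: integrable_fin_num => //; exact: (integrableD measurableT iX ib).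
have e2 : (\int[P]_w \int[P]_w' phi (X n m w', Y w))%E =
    ((\int[P]_w f (c_ n w))%R + b)%:E.
  transitivity (\int[P]_w (f (c_ n w) + b)%:E)%E; last first.
    rewrite -{2}(Rintegral_probability_cst P b) -RintegralD// /Rintegral fineK//.
    apply: integrable_fin_num => //; exact: (integrableD measurableT ifc ib).
  (* The iterate is frozen at outcome [w] while the sample varies with [w']; the inner integral is
     then [f] at that iterate, shifted by [b]. *)
  apply: eq_integral => w _.
  have Fc := psgd_in n w.
  have ic : P.-integrable setT (EFin \o (fun w' => cost (X n m w') (c_ n w))).
    exact: (cost_comp_integrable (mX n m)).
  transitivity (\int[P]_w' (cost (X n m w') (c_ n w) + b)%:E)%E.
    by apply: eq_integral => w' _; rewrite phiE ?tY.
  rewrite -{2}(Rintegral_probability_cst P b) -(expected_cost_sample n m Fc).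
  rewrite -RintegralD// /Rintegral fineK//.
  by apply: integrable_fin_num => //; exact: (integrableD measurableT ic ib).
by move: h; rewrite e1 e2 => -[/addIr].
Qed.

Lemma fexp_mean_le J (x : nat -> 'rV[R]_N) : (0 < J)%N ->
  (forall n, inF CM (x n)) ->
  f (J%:R^-1 *: \sum_(n < J) x n) <= J%:R^-1 * \sum_(n < J) f (x n).
Proof.
move=> J0 Fx.
have [isum Esum] := Rintegral_sum (index_enum 'I_J)
  (fun n : 'I_J => cost_eps_integrable (Fx n)).
have -> : \sum_(n < J) f (x n) = (\int[P]_w \sum_(n < J) cost (eps w) (x n))%R.
  exact/esym.
rewrite -RintegralZl//; apply: le_Rintegral => //.
- exact/cost_eps_integrable/inF_mean.
- exact: (integrableZl measurableT J%:R^-1 isum).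
- by move=> w _; apply: cost_mean_le.
Qed.

Lemma subgrad_bound n c w i : inF CM c -> `|subgrad K cM r p X n c w 0 i| <= B.
Proof.
move=> Fc; rewrite mxE summxE normrM ger0_norm ?invr_ge0//.
rewrite ler_pdivrMl ?ltr0n//; apply: le_trans (ler_norm_sum _ _ _) _.
rewrite mulr_natl -[X in _ *+ X]card_ord -sumr_const; apply: ler_sum => m _.
exact: subgrad1_bound.
Qed.

Lemma pathwise_regret : exists C, forall w z J, inF CM z ->
  \sum_(n < J) dotp (subgrad K cM r p X n (c_ n w) w) (c_ n w - z) <=
  C * Num.sqrt J%:R.
Proof.
have : 0 <= B by exact: slope_bound_ge0.
(* If [B = 0] the step size has a zero denominator, but all subgradients vanish and the constant [0]
   works. *)
rewrite le_eqVlt => /predU1P[B0|B0].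
  exists 0 => w z J Fz; rewrite mul0r; apply: sumr_le0 => n _.
  apply: le_trans (ler_norm _) _; rewrite [leRHS](_ : 0 = B * l1norm (c_ n w - z)).
    by apply: normr_dotp_le => i; exact: subgrad_bound (psgd_in n w).
  by rewrite -B0 mul0r.
pose D := if N == 1%N then CM else Num.sqrt 2 * CM.
pose a := D / (Num.sqrt N%:R * B).
have D0 : 0 < D.
  have C0 := capacity_gt0 K0 cM0.
  by rewrite /D; case: ifP => // _; rewrite mulr_gt0// sqrtr_gt0.
have a0 : 0 < a by rewrite divr_gt0// mulr_gt0// sqrtr_gt0 ltr0n.
(* The constant of [regret_sqrt_bound], with squared distances at most [N * CM ^ 2] and squared
   subgradient norms at most [N * B ^ 2]; neither depends on the outcome. *)
exists (N%:R * CM ^+ 2 / (2 * a) + a * (N%:R * B ^+ 2)) => w z J Fz.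
pose s n := dotp (subgrad K cM r p X n (c_ n w) w) (c_ n w - z).
apply: (@regret_sqrt_bound _ a (N%:R * B ^+ 2) (N%:R * CM ^+ 2) s
  (fun n => sqnorm (c_ n w - z))) => //.
- by rewrite mulr_ge0// sqr_ge0.
- by move=> n; rewrite sqnorm_ge0/=; apply: inF_sqnormB => //; exact: psgd_in.
move=> n /=; rewrite /s.
(* The update from [c_ n] to [c_ n.+1] uses the step size of index [n.+1]. *)
have -> : a / Num.sqrt n.+1%:R = stepsize K CM r p n.+1.
  by rewrite /stepsize /a -/D -mulrA -invfM.
have := proj_step_sqnorm projP (c_ n w) (subgrad K cM r p X n (c_ n w) w)
  (stepsize K CM r p n.+1) Fz.
have := sqnorm_le_coord (fun i => subgrad_bound n w i (psgd_in n w)).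
set t := stepsize _ _ _ _ _; set g := subgrad _ _ _ _ _ _ _ _ => gB step.
have : t ^+ 2 * sqnorm g <= t ^+ 2 * (N%:R * B ^+ 2) by rewrite ler_wpM2l// sqr_ge0.
lra.
Qed.

(** The subgradient inequality for each sample is averaged over the batch. *)
Lemma linearized_regret n w z : inF CM z ->
  M%:R^-1 * \sum_(m < M) (cost (X n m w) (c_ n w) - cost (X n m w) z) <=
  dotp (subgrad K cM r p X n (c_ n w) w) (c_ n w - z).
Proof.
move=> Fz; rewrite dotpZl dotp_suml ler_wpM2l ?invr_ge0//; apply: ler_sum => m _.
have := cost_subgradient p K0 cM0 rS (uX n m w) (psgd_in n w) Fz.
by rewrite -opprB dotpN /subgrad1; lra.
Qed.

Lemma expected_regret : exists C, forall z J, inF CM z ->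
  \sum_(n < J) ((\int[P]_w f (c_ n w))%R - f z) <= C * Num.sqrt J%:R.
Proof.
have [C regC] := pathwise_regret; exists C => z J Fz.
pose h n m w := cost (X n m w) (c_ n w) - cost (X n m w) z.
have iX n m : P.-integrable setT (EFin \o (fun w => cost (X n m w) (c_ n w))).
  apply: (cost_comp_integrable (mX n m)) => //; first exact: measurable_psgd_coord.
  exact: psgd_in.
have iz n m : P.-integrable setT (EFin \o (fun w => cost (X n m w) z)).
  exact: (cost_comp_integrable (mX n m)).
have ih n m : P.-integrable setT (EFin \o h n m).
  exact: (integrableB measurableT (iX n m) (iz n m)).
(* Independence enters here: the expected per-sample gap is the gap in [f], the same for all [m], so
   averaging over the batch preserves it. *)
have Eh n m : (\int[P]_w h n m w)%R = (\int[P]_w f (c_ n w))%R - f z.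
  by rewrite RintegralB// expected_cost_at_iterate expected_cost_sample.
have sm n := Rintegral_sum (index_enum 'I_M) (ih n).
have im n : P.-integrable setT (EFin \o (fun w => M%:R^-1 * \sum_(m < M) h n m w)).
  exact: (integrableZl measurableT M%:R^-1 (sm n).1).
have [iJ EJ] := Rintegral_sum (index_enum 'I_J) (fun n : 'I_J => im n).
have -> : \sum_(n < J) ((\int[P]_w f (c_ n w))%R - f z) =
    (\int[P]_w \sum_(n < J) (M%:R^-1 * \sum_(m < M) h n m w))%R.
  rewrite EJ; apply: eq_bigr => n _; rewrite RintegralZl//; last exact: (sm n).1.
  rewrite (sm n).2 (eq_bigr _ (fun m _ => Eh n m)).
  by rewrite sumr_const card_ord -[X in _ * X]mulr_natl mulKf// pnatr_eq0 -lt0n.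
rewrite -[leRHS](Rintegral_probability_cst P); apply: le_Rintegral => //.
  exact: finite_measure_integrable_cst.
move=> w _; apply: le_trans (regC w z J Fz).
by apply: ler_sum => n _; exact: linearized_regret.
Qed.

Lemma expected_fexp_cbar_cvg z : inF CM z -> (forall c, inF CM c -> f z <= f c) ->
  ((fun J : nat => \int[P]_w (f (cbar_ J w))%:E)%E @ \oo --> (f z)%:E)%E.
Proof.
move=> Fz zmin.
have icb J : P.-integrable setT (EFin \o (fun w => f (cbar_ J w))).
  apply: fexp_comp_integrable; last exact: cbar_in.
  exact: measurable_cbar.
have -> : (fun J : nat => \int[P]_w (f (cbar_ J w))%:E)%E =
    (fun J => (\int[P]_w f (cbar_ J w))%R%:E).
  by apply/funext => J; rewrite fineK//; exact: integrable_fin_num (icb J).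
have [C regC] := expected_regret.
apply: cvg_EFin; first by near=> J.
(* Shifting the index discards the empty average at [J = 0] and turns the error into
   [C * sqrt (harmonic J)], where [harmonic J] is [1 / (J + 1)]. *)
rewrite -cvg_shiftS.
have lim0 : (fun J => f z + C * Num.sqrt (harmonic J)) @ \oo --> f z + C * 0.
  apply: cvgD; first exact: cvg_cst.
  apply: cvgM; first exact: cvg_cst.
  have := cvg_comp _ _ (@cvg_harmonic R) (@sqrt_continuous R 0).
  by rewrite sqrtr0.
rewrite mulr0 addr0 in lim0.
apply: (squeeze_cvgr _ (cvg_cst (f z)) lim0); near=> J; apply/andP; split.
  rewrite -[leLHS](Rintegral_probability_cst P); apply: le_Rintegral => //.
    exact: finite_measure_integrable_cst.
  by move=> w _; exact/zmin/cbar_in.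
have ifc n : P.-integrable setT (EFin \o (fun w => f (c_ n w))).
  by apply: fexp_comp_integrable; [exact: measurable_psgd_coord|exact: psgd_in].
have [iJ EJ] := Rintegral_sum (index_enum 'I_J.+1) (fun n : 'I_J.+1 => ifc n).
(* Upper bound: convexity passes from the average iterate to the average of the expected values, to
   which the regret bound applies. *)
apply: (@le_trans _ _ (J.+1%:R^-1 * \sum_(n < J.+1) (\int[P]_w f (c_ n w))%R)).
  have <- := EJ; rewrite -RintegralZl//; apply: le_Rintegral => //.
    exact: (integrableZl measurableT J.+1%:R^-1 iJ).
  by move=> w _; apply: (fexp_mean_le (x := c_ ^~ w)) => // n; exact: psgd_in.
have Jinv : 0 < J.+1%:R^-1 :> R by rewrite invr_gt0.
have := regC z J.+1 Fz.
rewrite sumrB sumr_const card_ord -[f z *+ _]mulr_natl lerBlDl -(ler_pM2l Jinv).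
move=> /le_trans; apply; rewrite mulrDr mulKf// lerD2l mulrCA.
rewrite /harmonic sqrtrV// -[X in X^-1 * _]sqr_sqrtr// expr2 invfM -mulrA mulVf ?mulr1//.
Unshelve. all: by end_near. Qed.

End expected_cost.

(** * Reduction of samples almost surely in the unit box to samples everywhere in it *)

Definition clip (R : realType) (N : nat) (e : N.-tuple R) : N.-tuple R :=
  [tuple if 0 <= tnth e i then if tnth e i <= 1 then tnth e i else 0 else 0 | i < N].

Section clip.
Context (R : realType) (N : nat).
Implicit Type e : N.-tuple R.

(** Coordinates outside [[0, 1]] become [0] instead of the nearest endpoint; what matters is that
    the result lies in the box and that points of the box are fixed. *)
Lemma unit_box_clip e : unit_box (clip e).
Proof.
move=> i; rewrite tnth_mktuple; case: ifP => [e0|_]; last by rewrite lexx ler01.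
by case: ifP => [e1|_]; rewrite ?e0 ?e1 ?lexx ?ler01.
Qed.

Lemma clip_id e : unit_box e -> clip e = e.
Proof.
by move=> ue; apply: eq_from_tnth => i; rewrite tnth_mktuple; have /andP[-> ->] := ue i.
Qed.

Lemma measurable_clip : measurable_fun setT (@clip R N).
Proof.
apply/measurable_fun_tnthP => i.
rewrite (_ : _ \o _ = fun e : N.-tuple R =>
    if 0 <= tnth e i then if tnth e i <= 1 then tnth e i else 0 else 0); last first.
  by apply/funext => e; exact: tnth_mktuple.
have mi : measurable_fun setT (fun e : N.-tuple R => tnth e i) by exact: measurable_tnth.
by apply: measurable_fun_ifT => //; [exact: measurable_fun_ler|
  apply: measurable_fun_ifT => //; exact: measurable_fun_ler].
Qed.

Lemma measurable_unit_box : measurable [set e : N.-tuple R | unit_box e].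
Proof.
rewrite -[X in measurable X]setCK; apply: measurableC.
rewrite (_ : ~` _ = \bigcup_(i : 'I_N)
    (fun e : N.-tuple R => tnth e i) @^-1` (~` `[0, 1]%classic)); last first.
  apply/seteqP; split=> [e /= /existsNP[i ei]|e [i _ /= ei] ue].
    by exists i => //=; rewrite in_itv.
  by apply: ei; rewrite in_itv/=; exact: ue.
apply: countable_bigcupT_measurable => [|i]; first exact: countableP.
rewrite -[X in measurable X]setTI; apply: measurable_tnth => //.
by apply: measurableC; exact: measurable_itv.
Qed.

End clip.

Section almost_sure_box.
Context (R : realType) (d : measure_display) (Omega : measurableType d)
  (P : probability Omega R) (N M : nat).

Lemma ae_unit_box (E : Omega -> N.-tuple R) : measurable_fun setT E ->
  P (E @^-1` [set e | unit_box e]) = 1%E -> {ae P, forall w, unit_box (E w)}.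
Proof.
move=> mE PE; have mA : measurable (E @^-1` [set e | unit_box e]).
  by rewrite -[X in measurable X]setTI; apply: mE => //; exact: measurable_unit_box.
exists (~` (E @^-1` [set e | unit_box e])); split => //.
  exact: measurableC.
by rewrite probability_setC// PE subee.
Qed.

Lemma ae_unit_box_family (X : nat -> 'I_M -> Omega -> N.-tuple R) :
  (forall n m, {ae P, forall w, unit_box (X n m w)}) ->
  {ae P, forall w, forall n m, unit_box (X n m w)}.
Proof.
move=> h.
(* Ordinals are unpacked into a natural number and a bound, so that both quantifiers range over
   [nat] and countable intersections of almost sure events apply. *)
have : {ae P, forall w, forall n k (kM : (k < M)%N), unit_box (X n (Ordinal kM) w)}.
  apply: ae_foralln => n; apply: ae_foralln => k.
  have [kM|Mk] := pselect (k < M)%N.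
    apply: filterS (h n (Ordinal kM)) => w hw kM'.
    by rewrite (bool_irrelevance kM' kM).
  by apply: nearW => w kM.
apply: filterS => w hw n m; have := hw n m (ltn_ord m).
by congr (unit_box (X n _ w)); exact: val_inj.
Qed.

End almost_sure_box.

Lemma psgd_clip (R : realType) (K N M : nat) (CM : R) (cM r : nat -> R)
    (p : 'rV[R]_N) (proj : 'rV[R]_N -> 'rV[R]_N) (c1 : 'rV[R]_N) (T : Type)
    (X : nat -> 'I_M -> T -> N.-tuple R) (w : T) :
  (forall n m, unit_box (X n m w)) -> forall n,
  psgd K CM cM r p proj c1 (fun n m => @clip R N \o X n m) n w =
  psgd K CM cM r p proj c1 X n w.
Proof.
move=> uX; elim=> [//|n IH] /=; rewrite IH; congr (proj (_ - _ *: (_ *: _))).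
by apply: eq_bigr => m _; rewrite /comp clip_id.
Qed.

Lemma fexp_clip (R : realType) (d : measure_display) (Omega : measurableType d)
    (P : probability Omega R) (K N : nat) (cM r : nat -> R) (p : 'rV[R]_N)
    (eps : Omega -> N.-tuple R) :
  measurable_fun setT eps -> {ae P, forall w, unit_box (eps w)} ->
  fexp P K cM r p (@clip R N \o eps) = fexp P K cM r p eps.
Proof.
move=> meps ueps; apply/funext => c; congr fine; apply: ae_eq_integral => //.
- apply/measurable_EFinP/measurable_cost => //.
  by apply: measurableT_comp => //; exact: measurable_clip.
- exact/measurable_EFinP/measurable_cost.
- by apply: filterS ueps => w uw _ /=; rewrite clip_id.
Qed.

Theorem theorem2 (R : realType) (d : measure_display) (Omega : measurableType d)
  (P : probability Omega R) (K N M : nat) (cM r : nat -> R) (p : 'rV[R]_N)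
  (eps : Omega -> N.-tuple R) (X : nat -> 'I_M -> Omega -> N.-tuple R)
  (proj : 'rV[R]_N -> 'rV[R]_N) (c1 : 'rV[R]_N) :
  (0 < K)%N -> (0 < N)%N -> (0 < M)%N ->
  (forall k, (k < K)%N -> 0 < cM k) ->
  0 <= r 0%N ->
  (forall k, (k.+1 < K)%N -> r k < r k.+1) ->
  (forall i, 0 <= p 0 i) ->
  measurable_fun setT eps ->
  P [set w | forall i, 0 <= tnth (eps w) i <= 1] = 1%E ->
  (forall n m, measurable_fun setT (X n m)) ->
  (forall n m (B : set (N.-tuple R)), measurable B ->
     P (X n m @^-1` B) = P (eps @^-1` B)) ->
  mutually_independent P (fun s : nat * 'I_M => X s.1 s.2) ->
  is_proj_F (\sum_(k < K) cM k) proj ->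
  inF (\sum_(k < K) cM k) c1 ->
  convex_on_F (\sum_(k < K) cM k) (fexp P K cM r p eps) /\
  exists cstar : 'rV[R]_N,
    [/\ inF (\sum_(k < K) cM k) cstar,
        (forall c, inF (\sum_(k < K) cM k) c ->
           fexp P K cM r p eps cstar <= fexp P K cM r p eps c) &
        ((fun J : nat => \int[P]_w
            (fexp P K cM r p eps
               (cbar K (\sum_(k < K) cM k) cM r p proj c1 X J w))%:E)%E
          @ \oo --> (fexp P K cM r p eps cstar)%:E)%E].
Proof.
move=> K0 N0 M0 cM0 r0 rS p0 meps eps1 mX lawX indX projP Fc1.
(* Clipped samples are in the box for every outcome; equality of laws and independence carry over by
   taking preimages under the measurable map [clip]. *)
pose eps' := @clip R N \o eps; pose X' n m := @clip R N \o X n m.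
have mclip := @measurable_clip R N.
have meps' : measurable_fun setT eps' by exact: measurableT_comp.
have mX' n m : measurable_fun setT (X' n m) by exact: measurableT_comp.
have mpre (B : set (N.-tuple R)) : measurable B -> measurable (@clip R N @^-1` B).
  by move=> mB; rewrite -[Y in measurable Y]setTI; exact: mclip.
have lawX' n m (B : set (N.-tuple R)) : measurable B ->
    P (X' n m @^-1` B) = P (eps' @^-1` B).
  by move=> mB; exact: (lawX n m _ (mpre _ mB)).
have indX' : mutually_independent P (fun s : nat * 'I_M => X' s.1 s.2).
  move=> S B uS mB.
  exact: (indX S (fun i => @clip R N @^-1` B i) uS (fun i iS => mpre _ (mB i iS))).
have ueps : {ae P, forall w, unit_box (eps w)} by exact: ae_unit_box.
have uX : {ae P, forall w, forall n m, unit_box (X n m w)}.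
  apply: ae_unit_box_family => n m; apply: ae_unit_box => //.
  by rewrite lawX//; exact: measurable_unit_box.
have ueps' w : unit_box (eps' w) by exact: unit_box_clip.
have uX' n m w : unit_box (X' n m w) by exact: unit_box_clip.
rewrite -(fexp_clip K cM r p meps ueps) -/eps'; split; first exact: fexp_convex.
have [c Fc cmin] := fexp_minimizer P K0 cM0 r0 rS p0 meps' projP ueps'.
exists c; split => //.
pose f := fexp P K cM r p eps'.
pose cbar' (Y : nat -> 'I_M -> Omega -> N.-tuple R) :=
  cbar K (\sum_(k < K) cM k) cM r p proj c1 Y.
(* Stated for any measurable family, since comparing integrals of almost everywhere equal functions
   needs measurability for both [X] and [X']. *)
have mf (Y : nat -> 'I_M -> Omega -> N.-tuple R) J :
    (forall n m, measurable_fun setT (Y n m)) ->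
    measurable_fun setT (EFin \o (fun w => f (cbar' Y J w))).
  move=> mY; apply: (measurable_int P); apply: (fexp_comp_integrable _ _ _ _ _ _ _ projP) => //.
    exact: measurable_cbar.
  exact: cbar_in.
have cbarE : (fun J : nat => \int[P]_w (f (cbar' X J w))%:E)%E =
    (fun J : nat => \int[P]_w (f (cbar' X' J w))%:E)%E.
  apply/funext => J; apply: ae_eq_integral; [by []|exact: mf|exact: mf|].
  apply: filterS uX => w uw _; congr (f _)%:E; congr (_ *: _).
  by apply: eq_bigr => n _; rewrite psgd_clip.
rewrite [X in X @ _]cbarE.
exact: (expected_fexp_cbar_cvg K0 N0 M0 cM0 r0 rS p0 meps' mX' lawX' indX' projP Fc1
  ueps' uX' Fc cmin).
Qed.
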